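(* Let $p$ be a prime. For every strictly increasing sequence $(m_n)_{n\in\mathbb{N}}$ of natural numbers, the group $\bigoplus_{n\in\mathbb{N}}\mathbb{Z}(p^{m_n})$ admits a non-discrete locally quasi-convex UFSS (and hence locally minimal) group topology.
   Context: $\mathbb{Z}(k)$ is the cyclic group of order $k$. For a symmetric subset $U\ni 0$ of an abelian group $G$ and $n\in\mathbb{N}$ (positive integers), $(1/n)U:=\{x\in G: kx\in U\ \forall k\in\{1,\dots,n\}\}$. A Hausdorff topological group $(G,\tau)$ is UFSS (uniformly free from small subgroups) if for some symmetric neighborhood $U$ of $0$ the sets $(1/n)U$, $n\in\mathbb{N}$, form a neighborhood basis at $0$ for $\tau$. Let $\mathbb{T}=\mathbb{R}/\mathbb{Z}$, $q:\mathbb{R}\to\mathbb{T}$ the canonical projection and $\mathbb{T}_+=q([-1/4,1/4])$. For a topological abelian group $G$, $G^\wedge$ is the group of continuous homomorphisms $G\to\mathbb{T}$. A subset $A\subseteq G$ is quasi-convex if for every $x\in G\setminus A$ there is $\chi\in G^\wedge$ with $\chi(A)\subseteq\mathbb{T}_+$ and $\chi(x)\notin\mathbb{T}_+$. A topological abelian group is locally quasi-convex if it has a basis of neighborhoods of $0$ consisting of quasi-convex sets. A Hausdorff topological group $(G,\tau)$ is locally minimal if there exists a neighborhood $V$ of $0$ such that whenever $\sigma\subseteq\tau$ is a Hausdorff group topology on $G$ for which $V$ is a $\sigma$-neighborhood of $0$, then $\sigma=\tau$. *)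

(* Defs.v *)
From HB Require Import structures.
From mathcomp Require Import all_boot all_order all_algebra.
From mathcomp Require Import archimedean generic_quotient ring_quotient.
From mathcomp Require Import all_classical all_reals all_analysis.

Set Implicit Arguments.
Unset Strict Implicit.
Unset Printing Implicit Defensive.

Import Order.TTheory GRing.Theory Num.Theory.
Import numFieldNormedType.Exports.

Local Open Scope classical_set_scope.
Local Open Scope ring_scope.

Section DirectSum.
Context {I : Type} (G : I -> zmodType).

Definition dprod : Type := forall i, G i.

HB.instance Definition _ := gen_eqMixin dprod.
HB.instance Definition _ := gen_choiceMixin dprod.

Let addp (f g : dprod) : dprod := fun i => f i + g i.
Let zerop : dprod := fun=> 0.
Let oppp (f : dprod) : dprod := fun i => - f i.

Let addpA : associative addp.
Proof. by move=> f g h; apply: functional_extensionality_dep => i; exact: addrA. Qed.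
Let addpC : commutative addp.
Proof. by move=> f g; apply: functional_extensionality_dep => i; exact: addrC. Qed.
Let add0p : left_id zerop addp.
Proof. by move=> f; apply: functional_extensionality_dep => i; exact: add0r. Qed.
Let addNp : left_inverse zerop oppp addp.
Proof. by move=> f; apply: functional_extensionality_dep => i; exact: addNr. Qed.

HB.instance Definition _ :=
  GRing.isZmodule.Build dprod addpA addpC add0p addNp.

Definition finsupported : {pred dprod} :=
  fun f => `[< finite_set [set i | f i != 0] >].

Fact finsupported_zmod_closed : zmod_closed finsupported.
Proof.
split=> [|f g /asboolP ff /asboolP fg]; apply/asboolP.
  by rewrite (_ : [set _ | _] = set0) //; apply/seteqP; split=> i //= /eqP.
apply: sub_finite_set (_ : _ `<=` [set i | f i != 0] `|` [set i | g i != 0]) _.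
  move=> i /=; apply: contraPP => /not_orP[/negP/negPn/eqP fi0 /negP/negPn/eqP gi0].
  apply/negP/negPn; rewrite [(f - g) i]/(f i - g i) fi0 gi0; apply/eqP; exact: subrr.
by rewrite finite_setU.
Qed.

HB.instance Definition _ :=
  GRing.isZmodClosed.Build dprod finsupported finsupported_zmod_closed.

Record direct_sum : Type := DirectSum {
  dsum_val : dprod;
  dsum_finsupported : dsum_val \in finsupported }.

HB.instance Definition _ := [isSub for dsum_val].
HB.instance Definition _ := [Choice of direct_sum by <:].
HB.instance Definition _ := [SubChoice_isSubZmodule of direct_sum by <:].

End DirectSum.

Section GroupTopology.
Context {G : zmodType}.

Record topology_on : Type := TopologyOn {
  opens : set_system G;
  opensT : opens setT;
  opensI : setI_closed opens;
  opens_bigcup : forall F : set_system G,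
    F `<=` opens -> opens (\bigcup_(A in F) A) }.

Definition space (tau : topology_on) : Type := G.

Section Space.
Variable tau : topology_on.
HB.instance Definition _ := GRing.Zmodule.copy (space tau) G.

Let bigU (I : Type) (f : I -> set (space tau)) :
  (forall i, opens tau (f i)) -> opens tau (\bigcup_i f i).
Proof.
move=> fo; rewrite -(bigcup_image setT f id); apply: opens_bigcup.
by move=> _ [i _ <-].
Qed.

HB.instance Definition _ := isOpenTopological.Build (space tau)
  (@opensT tau) (@opensI tau) bigU.
End Space.

Record group_topology : Type := GroupTopology {
  gtop :> topology_on;
  gtop_sub_continuous :
    continuous (fun x : space gtop * space gtop => (x.1 - x.2 : space gtop)) }.

Definition tgroup (tau : group_topology) : Type := space tau.

HB.instance Definition _ (tau : group_topology) :=
  PreTopologicalZmodule.copy (tgroup tau) (space tau).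
HB.instance Definition _ (tau : group_topology) :=
  PreTopologicalNmodule_isTopologicalZmodule.Build (tgroup tau)
    (@gtop_sub_continuous tau).
End GroupTopology.
Arguments topology_on : clear implicits.
Arguments group_topology : clear implicits.

Definition integers (R : realType) : {pred R} := fun x => x \is a Num.int.

Fact integers_zmod_closed (R : realType) : zmod_closed (@integers R).
Proof. by split=> [|x y xi yi]; [exact: int_num0 | exact: rpredB]. Qed.

HB.instance Definition _ (R : realType) :=
  GRing.isZmodClosed.Build R (@integers R) (@integers_zmod_closed R).

Definition RmodZ (R : realType) : Type := Quotient.quot (@integers R).
HB.instance Definition _ (R : realType) :=
  ZmodQuotient.copy (RmodZ R) (Quotient.quot (@integers R)).

Definition circle (R : realType) : Type := quotient_topology (RmodZ R).
HB.instance Definition _ (R : realType) := Topological.on (circle R).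
(* Not a copy of the structure of RmodZ: its choice operator differs from the
   one that quotient_topology comes with. *)
HB.instance Definition _ (R : realType) := GRing.isZmodule.Build (circle R)
  (@addrA (RmodZ R)) (@addrC (RmodZ R)) (@add0r (RmodZ R)) (@addNr (RmodZ R)).

Definition circle_proj (R : realType) (x : R) : circle R := (\pi_(RmodZ R) x)%qT.

Definition circle_plus (R : realType) : set (circle R) :=
  @circle_proj R @` `[- (1 / 4), 1 / 4].

Section TopologicalGroupNotions.
Variable G : topologicalZmodType.

Definition symmetric_set (U : set G) : Prop := forall x, U x -> U (- x).

Definition frac_set (n : nat) (U : set G) : set G :=
  [set x | forall k : nat, (1 <= k <= n)%N -> U (x *+ k)].

Definition UFSS : Prop :=
  hausdorff_space G /\
  exists U : set G, [/\ symmetric_set U, nbhs (0 : G) U &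
    nbhs (0 : G) = filter_from [set n | (0 < n)%N] (fun n => frac_set n U)].

Definition quasi_convex (R : realType) (A : set G) : Prop :=
  forall x, ~ A x ->
    exists chi : {additive G -> circle R},
      [/\ continuous chi, chi @` A `<=` @circle_plus R & ~ circle_plus (chi x)].

Definition locally_quasi_convex (R : realType) : Prop :=
  nbhs (0 : G) =
    filter_from [set A : set G | nbhs (0 : G) A /\ quasi_convex R A] id.

Definition locally_minimal : Prop :=
  hausdorff_space G /\
  exists2 V : set G, nbhs (0 : G) V &
    forall sigma : group_topology G,
      opens sigma `<=` open -> hausdorff_space (tgroup sigma) ->
      nbhs (0 : tgroup sigma) V -> opens sigma = open.

Definition discrete_group : Prop := forall A : set G, open A.
End TopologicalGroupNotions.

(* Main.v *)
(** Let chi_i be the character x |-> x_i / p^(m_i) + Z of the direct sum. The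
    topology of uniform convergence on the family (chi_i) has as neighbourhoods
    of 0 the balls B_n = {x | |chi_i(x)| <= 1/(4n) for all i}. Since a circle
    element z satisfies |z| <= 1/(4n) exactly when z, 2z, ..., nz all lie in
    T_+, one has B_n = (1/n)B_1, which gives UFSS, and the continuous
    characters k chi_i with k <= n witness that B_n is quasi-convex. The
    characters separate points, and a generator of the i-th summand lies in B_n
    as soon as p^(m_i) >= 4n, so the topology is not discrete. *)
Require Import Defs.
From HB Require Import structures.
From mathcomp Require Import all_boot all_order all_algebra.
From mathcomp Require Import archimedean generic_quotient ring_quotient lra.
From mathcomp Require Import all_classical all_reals all_analysis.

Set Implicit Arguments.
Unset Strict Implicit.
Unset Printing Implicit Defensive.

Import Order.TTheory GRing.Theory Num.Theory.
Local Open Scope quotient_scope.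
Import numFieldNormedType.Exports.

Local Open Scope classical_set_scope.
Local Open Scope ring_scope.

(** * The circle group and its half arc [circle_plus] *)

Section Circle.
Variable R : realType.

Fact circle_proj_is_zmod_morphism : zmod_morphism (@circle_proj R).
Proof. exact: (raddfB (\pi_(RmodZ R)%qT)). Qed.

HB.instance Definition _ := GRing.isZmodMorphism.Build R (circle R)
  (@circle_proj R) circle_proj_is_zmod_morphism.

Lemma circle_proj_continuous : continuous (@circle_proj R).
Proof. exact: (@pi_continuous _ (RmodZ R)). Qed.

Lemma circle_proj_surj (z : circle R) : exists r : R, z = circle_proj r.
Proof. by exists (repr (z : RmodZ R)); rewrite /circle_proj reprK. Qed.

Lemma eq_circle_proj (r s : R) :
  circle_proj r = circle_proj s <-> r - s \is a Num.int.
Proof.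
rewrite -[_ \is a _]/(r - s \in @integers R) Quotient.idealrBE.
by split=> [e|/eqP]; first exact/eqP.
Qed.

Lemma circle_proj_inj (r s : R) :
  `|r - s| < 1 -> circle_proj r = circle_proj s -> r = s.
Proof.
move=> rs1 /eq_circle_proj rs; apply/eqP; rewrite -subr_eq0.
by apply: contraTT rs1 => rs0; rewrite -leNgt norm_intr_ge1.
Qed.

Lemma circle_plus_proj (r : R) :
  `|r| <= 1 / 2 -> circle_plus (circle_proj r) -> `|r| <= 1 / 4.
Proof.
move=> r2 [s /=]; rewrite in_itv /= => s4 sr.
(* Both are representatives of the same point, at distance at most 3/4 < 1. *)
have <- : s = r.
  by apply: circle_proj_inj sr; move: r2; rewrite ler_norml ltr_norml; lra.
by rewrite ler_norml; lra.
Qed.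

(** Induction from n = 1: if z has a representative r with (n+1)|r| <= 1/4, then (n+2)|r| <= 1/2, as
    |r| <= (n+1)|r|. On [-1/2, 1/2] membership of (n+2)z in the arc forces (n+2)|r| <= 1/4, so the
    same r keeps working. *)
Lemma circle_fracP (n : nat) (z : circle R) : (0 < n)%N ->
  (forall k, (1 <= k <= n)%N -> circle_plus (z *+ k)) <->
  exists2 r : R, z = circle_proj r & `|r| *+ n <= 1 / 4.
Proof.
move=> n0; split=> [|[r -> rn] k /andP[k0 kn]]; last first.
  rewrite -raddfMn; exists (r *+ k) => //=.
  rewrite in_itv /= -ler_norml normrMn.
  by apply: le_trans rn; rewrite ler_wpMn2l.
elim: n n0 => // -[_ _|n IH _] Bz.
  have := Bz 1%N isT; rewrite mulr1n => -[r /=]; rewrite in_itv /= => r4 <-.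
  by exists r => //; rewrite mulr1n ler_norml; lra.
have [//|k /andP[k1 kn]|r zr rn] := IH; first by apply: Bz; rewrite k1 leqW.
exists r => //; rewrite -normrMn; apply: circle_plus_proj.
  have : `|r| <= `|r| *+ n.+1 by rewrite -[leLHS]mulr1n ler_wpMn2l.
  by rewrite normrMn [_ *+ n.+2]mulrS; lra.
by rewrite raddfMn /= -zr; apply: Bz; rewrite leqnn.
Qed.
End Circle.

(** * UFSS groups are locally minimal *)

Lemma mulrn_continuous (G : topologicalZmodType) n :
  continuous (fun x : G => x *+ n).
Proof.
elim: n => [|n IH] x; first exact: cvg_cst.
under [X in continuous_at _ X]eq_fun do rewrite mulrS.
apply: (@continuous_comp _ _ _ (fun y : G => (y, y *+ n)) (fun z => z.1 + z.2)).
  by apply: cvg_pair; [exact: cvg_id|exact: IH].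
exact: add_continuous.
Qed.

Lemma addr_continuous (G : topologicalZmodType) (x : G) :
  continuous (fun y : G => y + x).
Proof.
move=> y.
apply: (@continuous_comp _ _ _ (fun y : G => (y, x)) (fun z => z.1 + z.2)).
  by apply: cvg_pair; [exact: cvg_id|exact: cvg_cst].
exact: add_continuous.
Qed.

(** The UFSS set U itself serves as V. If U is a sigma-neighbourhood of 0, continuity of the
    multiples x *+ k for sigma makes every (1/n)U one too, being a finite intersection of preimages
    of U. These sets form a base at 0 for the finer topology, so the two topologies agree at 0, and
    by translation everywhere. *)
Lemma UFSS_locally_minimal (G : topologicalZmodType) :
  UFSS G -> locally_minimal G.
Proof.
move=> [hG [U [_ U0 nbhs0]]]; split=> //; exists U => // sigma sub_open _ sU.
apply/seteqP; split=> // A oA.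
have frac_sigma n : nbhs (0 : tgroup sigma) (frac_set n U).
  elim: n => [|n IH]; first by apply: filterS filterT => x _ [].
  have Un : nbhs (0 : tgroup sigma) [set x | U (x *+ n.+1)].
    apply: (@mulrn_continuous (tgroup sigma) n.+1 0).
    by rewrite mul0rn.
  apply: filterS (filterI IH Un) => x [xn xn1] k /andP[k1].
  by rewrite leq_eqVlt => /predU1P[->//|kn]; apply: xn; rewrite k1.
suff : open (A : set (tgroup sigma)) by [].
rewrite openE => x Ax.
have : nbhs (0 : G) [set y | A (y + x)].
  by apply: (@addr_continuous G x 0); rewrite add0r; apply: open_nbhs_nbhs.
rewrite nbhs0 => -[n _ fracA].
have : nbhs x ((fun y : tgroup sigma => y - x) @^-1` frac_set n U).
  by apply: (@addr_continuous (tgroup sigma) (- x) x); rewrite subrr.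
by apply: filterS => y /fracA /=; rewrite subrK.
Qed.

(** * The group topology of uniform convergence on a family of characters *)

Section CharTopology.
Variables (R : realType) (G : zmodType) (I : Type).
Variable chi : I -> {additive G -> circle R}.

(** Phrased by multiples in the arc instead of a norm on the circle, to match [frac_set];
    [char_ballP] recovers the bound 1/(4n). For n = 0 it is the whole group. *)
Definition char_ball (n : nat) : set G :=
  [set x | forall i k, (1 <= k <= n)%N -> circle_plus (chi i x *+ k)].

Lemma char_ballP n x : (0 < n)%N -> char_ball n x <->
  forall i, exists2 r : R, chi i x = circle_proj r & `|r| *+ n <= 1 / 4.
Proof.
by move=> n0; split=> xn i; [apply/circle_fracP => //; exact: xn|
  apply/circle_fracP].
Qed.

Lemma le_char_ball m n : (m <= n)%N -> char_ball n `<=` char_ball m.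
Proof.
move=> mn x xn i k /andP[k1 km]; apply: xn.
by rewrite k1 (leq_trans km).
Qed.

Lemma char_ball0 n : char_ball n 0.
Proof.
(* Passing to the smaller ball of index [n.+1] covers n = 0, which [char_ballP] excludes. *)
apply: (@le_char_ball n n.+1) => //; apply/char_ballP => // i; exists 0.
  by rewrite !raddf0.
by rewrite normr0 mul0rn; lra.
Qed.

Lemma char_ballN n x : (0 < n)%N -> char_ball n x -> char_ball n (- x).
Proof.
move=> n0 /char_ballP xn; apply/char_ballP => // i.
by have [//|r e rn] := xn _ i; exists (- r); rewrite ?normrN // !raddfN e.
Qed.

(** Representatives bounded by 1/(8n) add up to one bounded by 1/(4n). This halving plays the role
    of the triangle inequality. *)
Lemma char_ballD n x y : (0 < n)%N ->
  char_ball n.*2 x -> char_ball n.*2 y -> char_ball n (x + y).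
Proof.
move=> n0; have n20 : (0 < n.*2)%N by rewrite double_gt0.
move=> /char_ballP xn /char_ballP yn; apply/char_ballP => // i.
have [//|r er rn] := xn _ i; have [//|s es sn] := yn _ i.
exists (r + s); first by rewrite !raddfD er es.
have := ler_wMn2r n (ler_normD r s); rewrite mulrnDl.
by move: rn sn; rewrite -muln2 !mulrnA !mulr2n; lra.
Qed.

Definition char_opens : set_system G := [set A | forall x, A x ->
  exists2 n, (0 < n)%N & forall y, char_ball n (y - x) -> A y].

Fact char_opensT : char_opens setT.
Proof. by move=> x _; exists 1%N. Qed.

Fact char_opensI : setI_closed char_opens.
Proof.
move=> A B oA oB x [/oA[m m0 mA] /oB[n n0 nB]].
exists (maxn m n); first by rewrite leq_max m0.
move=> y xy; split; [apply: mA|apply: nB];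
  apply: le_char_ball xy; rewrite leq_max leqnn ?orbT //.
Qed.

Fact char_opens_bigcup (F : set_system G) :
  F `<=` char_opens -> char_opens (\bigcup_(A in F) A).
Proof.
move=> oF x [A FA /(oF A FA)[n n0 nA]]; exists n => // y /nA Ay.
by exists A.
Qed.

Definition char_topology_on :=
  TopologyOn char_opensT char_opensI char_opens_bigcup.

Lemma nbhs_char_topology_on (x : Defs.space char_topology_on) (A : set G) :
  nbhs x A <-> exists2 n, (0 < n)%N & forall y, char_ball n (y - x) -> A y.
Proof.
rewrite nbhsE; split=> [[B [oB Bx] BA]|[n n0 nA]].
  by have [n n0 nB] := oB _ Bx; exists n => // y /nB/BA.
(* The interior of A; it is open because a ball of index [k.*2] around y has all its points at the
   centre of such a ball inside A. *)
exists [set y | exists2 k, (0 < k)%N & forall z, char_ball k (z - y) -> A z].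
  split; last by exists n.
  move=> y [k k0 kA]; exists k.*2; rewrite ?double_gt0 // => z yz.
  exists k.*2; rewrite ?double_gt0 // => t zt; apply: kA.
  by rewrite -[t](subrK z) -addrA; exact: char_ballD.
by move=> y [k k0]; apply; rewrite subrr; exact: char_ball0.
Qed.

Fact char_sub_continuous : continuous
  (fun x : Defs.space char_topology_on * Defs.space char_topology_on =>
     (x.1 - x.2 : Defs.space char_topology_on)).
Proof.
move=> [x y] A /nbhs_char_topology_on[n n0 nA] /=.
exists ([set z | char_ball n.*2 (z - x)], [set z | char_ball n.*2 (z - y)]).
  by split; apply/nbhs_char_topology_on; exists n.*2; rewrite ?double_gt0.
move=> [z t] /= [xz yt]; apply: nA.
have -> : z - t - (x - y) = (z - x) + - (t - y).
  by rewrite !opprB addrACA [in RHS]addrACA [- t - x]addrC.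
by apply: char_ballD => //; apply: char_ballN; rewrite ?double_gt0.
Qed.

Definition char_topology := GroupTopology char_sub_continuous.

(** Restated over [tgroup], the type that carries the topological group structure. *)
Lemma nbhs_char_topology (x : tgroup char_topology) (A : set G) :
  nbhs x A <-> exists2 n, (0 < n)%N & forall y, char_ball n (y - x) -> A y.
Proof. exact: nbhs_char_topology_on. Qed.

Lemma nbhs0_char_topology (A : set (tgroup char_topology)) :
  nbhs (0 : tgroup char_topology) A <->
  exists2 n, (0 < n)%N & char_ball n `<=` A.
Proof.
split=> [/nbhs_char_topology|] [n n0 nA]; last apply/nbhs_char_topology;
  by exists n => // y; have := nA y; rewrite subr0.
Qed.

Lemma frac_set_char_ball n :
  frac_set n (char_ball 1 : set (tgroup char_topology)) = char_ball n.
Proof.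
apply/seteqP; split=> x xn.
  by move=> i k kn; have := xn k kn i 1%N isT; rewrite mulr1n raddfMn.
by move=> k kn i [|[]] // _; rewrite mulr1n raddfMn; apply: xn.
Qed.

(** Separation of points gives the Hausdorff property: if all neighbourhoods of x and y meet, then x
    - y lies in every ball, so each character sends it to a point with arbitrarily small
    representatives, that is, to 0. *)
Lemma UFSS_char_topology :
  (forall x : G, (forall i, chi i x = 0) -> x = 0) ->
  UFSS (tgroup char_topology).
Proof.
move=> chi_sep; split.
  move=> x y xy; apply/eqP; rewrite -subr_eq0; apply/eqP/chi_sep => i.
  have xyn n : (0 < n)%N -> char_ball n (x - y).
    move=> n0; have n20 : (0 < n.*2)%N by rewrite double_gt0.
    have [||z [xz yz]] := xy [set z | char_ball n.*2 (z - x)]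
      [set z | char_ball n.*2 (z - y)].
    - by apply/nbhs_char_topology; exists n.*2.
    - by apply/nbhs_char_topology; exists n.*2.
    have -> : x - y = - (z - x) + (z - y) by rewrite opprB addrA subrK.
    by apply: char_ballD => //; exact: char_ballN.
  have [r er r4] := (@char_ballP 1 _ isT).1 (xyn 1%N isT) i.
  suff r0 : r = 0 by rewrite er r0 raddf0.
  apply/eqP/negPn/negP => rn0; have rgt0 : 0 < `|r| by rewrite normr_gt0.
  (* This n exceeds 1/|r|. The representative s from the ball of index n equals r, since |r| and |s|
     are at most 1/4, and then n|r| <= 1/4 contradicts n|r| > 1. *)
  pose n := (Num.truncn (`|r|^-1)).+1.
  have [s es s4] := (@char_ballP n _ isT).1 (xyn n isT) i.
  have rs : r = s.
    apply: circle_proj_inj; last by rewrite -er.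
    have sn : `|s| <= `|s| *+ n by rewrite -[leLHS]mulr1n ler_wpMn2l.
    have := ler_normB r s; move: r4; rewrite mulr1n; lra.
  move: s4; rewrite -rs -mulr_natr.
  have : 1 < `|r| * n%:R by rewrite -ltr_pdivrMl // mulr1 truncnS_gt.
  lra.
exists (char_ball 1); split.
- by move=> x; exact: char_ballN.
- by apply/nbhs0_char_topology; exists 1%N.
- apply/seteqP; split=> A.
    by move=> /nbhs0_char_topology[n n0 nA]; exists n => //;
      rewrite frac_set_char_ball.
  move=> [n n0]; rewrite frac_set_char_ball => nA.
  by apply/nbhs0_char_topology; exists n.
Qed.

Lemma char_continuous i : continuous (chi i : tgroup char_topology -> circle R).
Proof.
move=> x W; have [r er] := circle_proj_surj (chi i x).
rewrite er => /circle_proj_continuous /nbhs_ballP[e /= e0 eW].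
apply/(nbhs_char_topology x (chi i @^-1` W)).
(* As n > 1/e, the bound 1/(4n) on a representative of the difference is below e. *)
pose n := (Num.truncn e^-1).+1; exists n => // y yx.
have [s] := (@char_ballP n _ isT).1 yx i.
rewrite raddfB => es s4.
suff : W (chi i y) by [].
rewrite -[chi i y](subrK (chi i x)) es er -raddfD.
apply: eW; rewrite /ball /= opprD addrC subrK normrN.
have : 1 < e * n%:R by rewrite -ltr_pdivrMl // mulr1 truncnS_gt.
move: s4; rewrite -mulr_natr => s4 e1.
rewrite -(@ltr_pM2r _ n%:R) ?ltr0n //; lra.
Qed.

Lemma quasi_convex_char_ball n :
  quasi_convex R (char_ball n : set (tgroup char_topology)).
Proof.
move=> x /existsNP[i /existsNP[k /not_implyP[kn xk]]].
(* The multiple of the character at which x violates the ball condition separates x from the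
   ball. *)
pose f (y : tgroup char_topology) : circle R := chi i y *+ k.
have f_is_zmod : zmod_morphism f.
  by move=> y z; rewrite /f raddfB mulrnBl.
pose F : {additive tgroup char_topology -> circle R} :=
  HB.pack f (GRing.isZmodMorphism.Build _ _ f f_is_zmod).
exists F; split=> //.
  have -> : (F : _ -> _) =
      (chi i : tgroup char_topology -> circle R) \o (fun y => y *+ k).
    by apply/funext => y /=; rewrite raddfMn.
  move=> y; apply: continuous_comp; last exact: char_continuous.
  exact: mulrn_continuous.
by move=> _ [y yn <-]; exact: yn.
Qed.

Lemma locally_quasi_convex_char_topology :
  locally_quasi_convex (tgroup char_topology) R.
Proof.
apply/seteqP; split=> A.
  move=> /nbhs0_char_topology[n n0 nA]; exists (char_ball n) => //.
  split; last exact: quasi_convex_char_ball.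
  by apply/nbhs0_char_topology; exists n.
by move=> [B [B0 _] BA]; exact: filterS BA B0.
Qed.

Lemma not_discrete_char_topology :
  (forall n, (0 < n)%N -> exists2 x, x != 0 & char_ball n x) ->
  ~ discrete_group (tgroup char_topology).
Proof.
move=> small disc.
have /nbhs0_char_topology[n n0 n1] : nbhs (0 : tgroup char_topology) [set 0].
  by apply: open_nbhs_nbhs; split.
by have [x x0 /n1/= xe] := small n n0; rewrite xe eqxx in x0.
Qed.
End CharTopology.

(** * Coordinates and one-coordinate elements of a direct sum *)

Section DirectSum.
Context {I : Type} {G : I -> zmodType}.

Definition dsum_coord (i : I) (x : direct_sum G) : G i := dsum_val x i.

Fact dsum_coord_is_zmod_morphism i : zmod_morphism (dsum_coord i).
Proof.
move=> x y; exact: (congr1 (fun f : dprod G => f i) (raddfB val x y)).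
Qed.

HB.instance Definition _ i := GRing.isZmodMorphism.Build (direct_sum G) (G i)
  (dsum_coord i) (dsum_coord_is_zmod_morphism i).

Lemma dsum_coord_inj (x y : direct_sum G) :
  (forall i, dsum_coord i x = dsum_coord i y) -> x = y.
Proof. by move=> xy; apply/val_inj/functional_extensionality_dep. Qed.
End DirectSum.

Lemma dsum_delta_exists (I : eqType) (G : I -> zmodType) (i : I) (a : G i) :
  exists x : direct_sum G, dsum_coord i x = a /\
    forall j, j != i -> dsum_coord j x = 0.
Proof.
pose f : dprod G := eqtype.dfwith (fun=> 0 : G _) a.
have fi : f i = a by exact: dfwith_in.
have fj j : j != i -> f j = 0 by rewrite eq_sym; exact: dfwith_out.
have fs : f \in @finsupported I G.
  apply/asboolP; apply: sub_finite_set (finite_set1 i) => j /=.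
  by apply: contraNP => /eqP ji; rewrite fj.
by exists (DirectSum fs).
Qed.

(** * The coordinate characters of a direct sum of cyclic groups *)

Section CyclicSum.
Variable R : realType.

(* 'I_n.+1 rather than 'Z_n, so that the denominator is the modulus for every n;
   'Z_n is convertible to 'I_(Zp_trunc n).+2. *)
Definition Zp_char (n : nat) (x : 'I_n.+1) : circle R :=
  circle_proj (x%:R / n.+1%:R).

Fact Zp_char_is_nmod_morphism n : nmod_morphism (@Zp_char n).
Proof.
split=> [|x y]; first by rewrite /Zp_char mul0r raddf0.
rewrite /Zp_char -raddfD -mulrDl -natrD; apply/esym/eq_circle_proj.
(* Addition in ['I_n.+1] takes the remainder modulo [n.+1], so the two fractions differ by the
   integer quotient. *)
rewrite -mulrBl [X in X%:R - _](divn_eq (x + y) n.+1) natrD addrK natrM.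
by rewrite mulfK ?pnatr_eq0.
Qed.

HB.instance Definition _ n := GRing.isNmodMorphism.Build 'I_n.+1 (circle R)
  (@Zp_char n) (Zp_char_is_nmod_morphism n).

Lemma Zp_char_eq0 n (x : 'I_n.+1) : Zp_char x = 0 -> x = 0.
Proof.
rewrite /Zp_char -(raddf0 (@circle_proj R)) => /circle_proj_inj e.
apply/val_inj/eqP; rewrite /= -(@pnatr_eq0 R).
have := e _; rewrite subr0 normrM normfV !normr_nat ltr_pdivrMr ?ltr0n //.
rewrite mul1r ltr_nat => /(_ (ltn_ord x))/eqP.
by rewrite mulf_eq0 invr_eq0 (pnatr_eq0 _ n.+1) orbF.
Qed.

Variable N : nat -> nat.
Let G := direct_sum (fun i => 'Z_(N i)).

Definition coord_char (i : nat) : {additive G -> circle R} :=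
  @Zp_char (Zp_trunc (N i)).+1 \o dsum_coord i.

Lemma coord_char_separating (x : G) : (forall i, coord_char i x = 0) -> x = 0.
Proof.
move=> x0; apply: dsum_coord_inj => i.
by rewrite raddf0; apply: Zp_char_eq0 (x0 i).
Qed.

Lemma coord_char_small (n i : nat) : (0 < n)%N -> (4 * n <= N i)%N ->
  exists2 x : G, x != 0 & char_ball coord_char n x.
Proof.
move=> n0 nN; have [x [xi xj]] := @dsum_delta_exists _ (fun i => 'Z_(N i)) i 1.
exists x.
  apply/eqP => x0; move: xi; rewrite x0 raddf0 => /eqP.
  by rewrite eq_sym oner_eq0.
apply/char_ballP => // j; have [->|ji] := eqVneq j i; last first.
  by exists 0; rewrite ?normr0 ?mul0rn /= ?xj ?raddf0 //; lra.
exists (1 / (N i)%:R).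
  rewrite /= xi; apply: (congr1 (fun M : nat => circle_proj (1 / M%:R))).
  (* The modulus of ['Z_(N i)] is N i only when N i > 1, which 4n <= N i ensures. *)
  by apply/Zp_cast; apply: leq_trans nN; rewrite (@leq_trans 4) // leq_pmulr.
have N0 : 0 < (N i)%:R :> R by rewrite ltr0n (leq_trans _ nN) // muln_gt0.
rewrite ger0_norm ?divr_ge0 // -[_ *+ n]mulr_natr mulrAC ler_pdivrMr //.
have : (4 * n)%:R <= (N i)%:R :> R by rewrite ler_nat.
rewrite natrM; lra.
Qed.

End CyclicSum.

Theorem lemma5p6 (R : realType) (p : nat) (m : nat -> nat)
    (p_prime : prime p)
    (m_gt0 : forall n, (0 < m n)%N)
    (m_incr : forall i j, (i < j)%N -> (m i < m j)%N) :
  exists tau : group_topology (direct_sum (fun n : nat => 'Z_(p ^ m n))),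
    [/\ ~ discrete_group (tgroup tau),
        locally_quasi_convex (tgroup tau) R,
        UFSS (tgroup tau) &
        locally_minimal (tgroup tau)].
Proof.
pose N n := (p ^ m n)%N; exists (char_topology (coord_char R N)).
have ufss := UFSS_char_topology (@coord_char_separating R N).
split=> //; last exact: UFSS_locally_minimal.
- apply: not_discrete_char_topology => n n0.
  (* The summand of index 4n is large enough: strict growth gives m k >= k, hence p^(m (4n)) > m
     (4n) >= 4n. *)
  apply: (@coord_char_small _ _ _ (4 * n)) => //.
  have le_m k : (k <= m k)%N.
    by elim: k => // k IH; apply: leq_ltn_trans IH (m_incr _ _ (ltnSn k)).
  by apply: leq_trans (le_m _) (ltnW (ltn_expl _ (prime_gt1 p_prime))).
- exact: locally_quasi_convex_char_topology.
Qed.
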